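(* Let $t = (t_{ijk} \mid 1 \leq i < j < k \leq 5) \in \mathbb{Z}^{10}$ be such that the presentation defining $G(t)$ is consistent. Then the multiplication in $G(t)$ can be described by Hall polynomials $p_i(a,b)$ with $1 \leq i \leq 5$; that is, for all $a = (a_1,\ldots,a_5), b = (b_1,\ldots,b_5) \in \mathbb{Z}^5$, $$(g_1^{a_1} \cdots g_5^{a_5}) \cdot (g_1^{b_1} \cdots g_5^{b_5}) = g_1^{p_1(a,b)} \cdots g_5^{p_5(a,b)},$$ and such polynomials are given by $$\begin{aligned} p_1 ={}& a_1 + b_1, \\ p_2 ={}& a_2 + b_2, \\ p_3 ={}& a_3 + b_3 + t_{123} a_2 b_1, \\ p_4 ={}& a_4 + b_4 + t_{124} a_2 b_1 + t_{134} a_3 b_1 + t_{234} a_3 b_2 \\ & + t_{123} t_{134} a_2 s_2(b_1) + t_{123} t_{234} s_2(a_2) b_1 + t_{123} t_{234} a_2 b_1 b_2, \\ p_5 ={}& a_5 + b_5 + t_{345} a_4 b_3 + t_{245} a_4 b_2 + t_{235} a_3 b_2 + t_{145} a_4 b_1 + t_{135} a_3 b_1 + t_{125} a_2 b_1 \\ & + t_{234} t_{345} s_2(a_3) b_2 + t_{234} t_{245} a_3 s_2(b_2) + t_{134} t_{345} s_2(a_3) b_1 + t_{134} t_{145} a_3 s_2(b_1) \\ & + t_{234} t_{345} a_3 b_2 b_3 + t_{134} t_{345} a_3 b_1 b_3 + t_{134} t_{245} a_3 b_1 b_2 + t_{124} t_{345} a_2 b_1 b_3 \\ & + t_{124} t_{345}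 a_2 a_3 b_1 + (t_{123} t_{235} + t_{124} t_{245}) a_2 b_1 b_2 \\ & + (t_{123} t_{235} + t_{124} t_{245}) s_2(a_2) b_1 + (t_{123} t_{135} + t_{124} t_{145}) a_2 s_2(b_1) \\ & + t_{123} t_{234} t_{245} a_2 b_1 s_2(b_2) + t_{123} t_{134} t_{245} s_2(a_2) s_2(b_1) + t_{123} t_{234} t_{245} s_3(a_2) b_1 \\ & + t_{123} t_{134} t_{145} a_2 s_3(b_1) + t_{123} t_{234} t_{245} s_2(a_2) b_1 b_2 + t_{123} t_{134} t_{245} a_2 s_2(b_1) b_2. \end{aligned}$$
   Context: Notation: $s_2(x) = x(x-1)/2$ and $s_3(x) = x(x-1)(x-2)/6$ (for all integers $x$, including negative ones). Commutator convention: $[x,y] = x^{-1}y^{-1}xy$, so that $xy = yx[x,y]$. For $t = (t_{ijk} \mid 1 \leq i < j < k \leq 5) \in \mathbb{Z}^{10}$, $G(t)$ denotes the group given by the presentation $$G(t) = \langle g_1, \ldots, g_5 \mid [g_j, g_i] = g_{j+1}^{t_{i,j,j+1}} \cdots g_5^{t_{i,j,5}} \text{ for } 1 \leq i < j \leq 5 \rangle,$$ where $t_{i,j,k}$ is the same as $t_{ijk}$ and the right-hand side is the empty product $1$ when $j = 5$. This is a polycyclic presentation, and $G(t)$ is a nilpotent group of Hirsch length at most $5$. The presentation is consistent (also: $G(t)$ is consistent) if and only if $G(t)$ has Hirsch length precisely $5$, or, equivalently, if the generators $(g_1, \ldots, g_5)$ form a $\mathcal{T}$-basis for $G(t)$,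 meaning that the subgroups $G_i = \langle g_i, \ldots, g_5 \rangle$ for $1 \leq i \leq 6$ define a central series $G(t) = G_1 > G_2 > \cdots > G_5 > G_6 = \{1\}$ with infinite quotients $G_i/G_{i+1}$ for $1 \leq i \leq 5$. In that case every element of $G(t)$ can be written uniquely as $g_1^{a_1} \cdots g_5^{a_5}$ with $a_1, \ldots, a_5 \in \mathbb{Z}$. Hall polynomials for a group with $\mathcal{T}$-basis $(g_1, \ldots, g_n)$ are polynomials $p_i(a,b)$, $1 \leq i \leq n$, in $a = (a_1, \ldots, a_n)$ and $b = (b_1, \ldots, b_n)$, describing functions $\mathbb{Z}^n \times \mathbb{Z}^n \to \mathbb{Z}$ with $(g_1^{a_1} \cdots g_n^{a_n}) \cdot (g_1^{b_1} \cdots g_n^{b_n}) = g_1^{p_1(a,b)} \cdots g_n^{p_n(a,b)}$ for all $a, b \in \mathbb{Z}^n$. *)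

(* Defs.v *)
From HB Require Import structures.
From mathcomp Require Import all_boot all_order all_algebra.
From mathcomp Require Import all_classical.
From mathcomp Require Import mpoly.

Set Implicit Arguments.
Unset Strict Implicit.
Unset Printing Implicit Defensive.

Import GRing.Theory.

Local Open Scope quotient_scope.
Local Open Scope classical_set_scope.
Local Open Scope group_scope.

Definition expgz (G : baseGroupType) (x : G) (m : int) : G :=
  match m with
  | Posz n => x ^+ n
  | Negz n => x ^- n.+1
  end.

(* The letter (i, false) is the i-th generator, (i, true) its formal inverse. *)
Definition word (n : nat) : Type := seq ('I_n * bool).

Definition word_mul n (u v : word n) : word n := u ++ v.
Definition word_one n : word n := [::].
Definition word_inv n (u : word n) : word n :=
  rev [seq (l.1, ~~ l.2) | l <- u].

(* Words are not reduced, so they only carry the operations of a group, not its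
   laws; this suffices for commutators, powers and products of words. *)
HB.instance Definition _ n := hasMul.Build (word n) (@word_mul n).
HB.instance Definition _ n := hasOne.Build (word n) (@word_one n).
HB.instance Definition _ n := hasInv.Build (word n) (@word_inv n).

Definition wgen n (i : 'I_n) : word n := [:: (i, false)].

Section Presentation.
Variables (n : nat) (R : word n -> word n -> Prop).

Inductive pres_eq : word n -> word n -> Prop :=
| Pres_rel u v : R u v -> pres_eq u v
| Pres_mulV u : pres_eq (u * u^-1) 1
| Pres_mul u u' v v' : pres_eq u u' -> pres_eq v v' ->
    pres_eq (u * v) (u' * v')
| Pres_refl u : pres_eq u u
| Pres_sym u v : pres_eq u v -> pres_eq v u
| Pres_trans u v w : pres_eq u v -> pres_eq v w -> pres_eq u w.

Definition pres_eqb : rel (word n) := fun u v => `[< pres_eq u v >].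

Lemma pres_eqb_refl : reflexive pres_eqb.
Proof. by move=> u; apply/asboolP; exact: Pres_refl. Qed.

Lemma pres_eqb_sym : ssrbool.symmetric pres_eqb.
Proof. by move=> u v; apply/asboolP/asboolP; exact: Pres_sym. Qed.

Lemma pres_eqb_trans : transitive pres_eqb.
Proof.
by move=> v u w /asboolP uv /asboolP vw; apply/asboolP; exact: Pres_trans vw.
Qed.

Canonical pres_equiv :=
  EquivRel pres_eqb pres_eqb_refl pres_eqb_sym pres_eqb_trans.

Definition pres_group := {eq_quot pres_equiv}.

HB.instance Definition _ := Choice.on pres_group.
HB.instance Definition _ := EqQuotient.on pres_group.

Definition pres_class (u : word n) : pres_group := \pi_pres_group u.

Lemma pres_classP u v : pres_class u = pres_class v <-> pres_eq u v.
Proof.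
by split=> [/eqP|uv]; [|apply/eqP]; rewrite /pres_class piE /=;
  [move/asboolP|apply/asboolP].
Qed.

Lemma pres_class_repr (x : pres_group) : pres_class (repr x) = x.
Proof. exact: reprK. Qed.

Lemma pres_eq_repr u : pres_eq (repr (pres_class u)) u.
Proof. by apply/pres_classP; rewrite pres_class_repr. Qed.

Definition pres_mul (x y : pres_group) := pres_class (repr x * repr y).
Definition pres_one : pres_group := pres_class 1.
Definition pres_inv (x : pres_group) := pres_class (repr x)^-1.

Lemma word_invK : involutive (@word_inv n).
Proof.
move=> u; rewrite /word_inv map_rev revK -map_comp -[RHS]map_id.
by apply: eq_map => -[i b] /=; rewrite negbK.
Qed.

Lemma pres_mulA : associative pres_mul.
Proof.
move=> x y z; apply/pres_classP.
apply: (@Pres_trans _ ((repr x : word n) * ((repr y : word n) * repr z))).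
  by apply: Pres_mul; [exact: Pres_refl|exact: pres_eq_repr].
rewrite [X in pres_eq X _](catA (repr x) (repr y) (repr z)).
by apply: Pres_sym; apply: Pres_mul; [exact: pres_eq_repr|exact: Pres_refl].
Qed.

Lemma pres_mul1 : left_id pres_one pres_mul.
Proof.
move=> x; rewrite -[RHS]pres_class_repr; apply/pres_classP.
apply: (@Pres_trans _ ((1 : word n) * repr x)); last exact: Pres_refl.
by apply: Pres_mul; [exact: pres_eq_repr|exact: Pres_refl].
Qed.

Lemma pres_1mul : right_id pres_one pres_mul.
Proof.
move=> x; rewrite -[RHS]pres_class_repr; apply/pres_classP.
apply: (@Pres_trans _ ((repr x : word n) * 1)); last first.
  by rewrite [X in pres_eq X _](cats0 (repr x)); exact: Pres_refl.
by apply: Pres_mul; [exact: Pres_refl|exact: pres_eq_repr].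
Qed.

Lemma pres_mulgV : right_inverse pres_one pres_inv pres_mul.
Proof.
move=> x; apply/pres_classP; apply: Pres_trans (Pres_mulV (repr x)).
by apply: Pres_mul; [exact: Pres_refl|exact: pres_eq_repr].
Qed.

Lemma pres_mulVg : left_inverse pres_one pres_inv pres_mul.
Proof.
move=> x; apply/pres_classP.
have := Pres_mulV (word_inv (repr x)).
rewrite (_ : (word_inv (repr x))^-1 = repr x); last exact: word_invK.
apply: Pres_trans.
by apply: Pres_mul; [exact: pres_eq_repr|exact: Pres_refl].
Qed.

HB.instance Definition _ := isGroup.Build pres_group
  pres_mulA pres_mul1 pres_1mul pres_mulVg pres_mulgV.

Definition pres_gen (i : 'I_n) : pres_group := pres_class (wgen i).

End Presentation.

Section TBasis.
Variable G : groupType.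

Inductive gensub (A : set G) : set G :=
| Gensub_gen x : A x -> gensub A x
| Gensub_one : gensub A 1
| Gensub_mul x y : gensub A x -> gensub A y -> gensub A (x * y)
| Gensub_inv x : gensub A x -> gensub A x^-1.

Definition lcosets (H K : set G) : set (set G) :=
  [set [set x * k | k in K] | x in H].

Definition normal_subgroup (H : set G) : Prop :=
  gensub H = H /\ forall x y, H x -> H (x ^ y).

Definition central_series (n : nat) (H : nat -> set G) : Prop :=
  [/\ H 0 = setT,
      H n = [set 1],
      (forall i, i <= n -> normal_subgroup (H i)),
      (forall i, i < n -> H i.+1 `<` H i) &
      (forall i x y, i < n -> H i x -> H i.+1 [~ x, y])].

Variables (n : nat) (g : 'I_n -> G).

(* Indices start at 0: [tailsub i] is the subgroup G_(i+1). *)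
Definition tailsub (i : nat) : set G :=
  gensub [set g k | k in [set k : 'I_n | (i <= k)%N]].

Definition is_T_basis : Prop :=
  central_series n tailsub /\
  forall i, i < n -> infinite_set (lcosets (tailsub i) (tailsub i.+1)).

Definition collected (a : 'rV[int]_n) : G :=
  \prod_(i < n) expgz (g i) (a ord0 i).

(* The variables of [p i] are a_1, ..., a_n, b_1, ..., b_n, in this order. *)
Definition Hall_polynomials (p : 'I_n -> {mpoly rat[n + n]}) : Prop :=
  forall a b : 'rV[int]_n, exists2 c : 'rV[int]_n,
    (forall i, (p i).@[fun k => (row_mx a b ord0 k)%:~R] = (c ord0 i)%:~R)%R &
    collected a * collected b = collected c.

End TBasis.

(* A family t in Z^10 is given by a function of which only the values t i j k
   with 1 <= i < j < k <= 5 matter. *)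
Definition family := nat -> nat -> nat -> int.

Inductive Grel (t : family) : word 5 -> word 5 -> Prop :=
| Grel_comm (i j : 'I_5) : i < j ->
    Grel t [~ wgen j, wgen i]
      (\prod_(k < 5 | j < k) expgz (wgen k) (t i.+1 j.+1 k.+1)).

Definition Gt (t : family) : groupType := pres_group (Grel t).

Definition Ggen (t : family) : 'I_5 -> Gt t := @pres_gen 5 (Grel t).

Definition consistent (t : family) : Prop := is_T_basis (@Ggen t).

Local Close Scope group_scope.
Local Open Scope ring_scope.

Definition s2 m (x : {mpoly rat[m]}) : {mpoly rat[m]} :=
  2%:R^-1 *: (x * (x - 1)).

Definition s3 m (x : {mpoly rat[m]}) : {mpoly rat[m]} :=
  6%:R^-1 *: (x * (x - 1) * (x - 2%:R)).

Section HallPoly.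
Variable t : family.

Let P := {mpoly rat[5 + 5]}.
Let a (i : nat) : P := 'X_(lshift 5 (inord i.-1)).
Let b (i : nat) : P := 'X_(rshift 5 (inord i.-1)).
Let T (i j k : nat) : P := (t i j k)%:~R.

Definition hall1 : P := a 1 + b 1.

Definition hall2 : P := a 2 + b 2.

Definition hall3 : P := a 3 + b 3 + T 1 2 3 * a 2 * b 1.

Definition hall4 : P :=
  a 4 + b 4 + T 1 2 4 * a 2 * b 1 + T 1 3 4 * a 3 * b 1 + T 2 3 4 * a 3 * b 2
  + T 1 2 3 * T 1 3 4 * a 2 * s2 (b 1) + T 1 2 3 * T 2 3 4 * s2 (a 2) * b 1
  + T 1 2 3 * T 2 3 4 * a 2 * b 1 * b 2.

Definition hall5 : P :=
  a 5 + b 5 + T 3 4 5 * a 4 * b 3 + T 2 4 5 * a 4 * b 2 + T 2 3 5 * a 3 * b 2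
  + T 1 4 5 * a 4 * b 1 + T 1 3 5 * a 3 * b 1 + T 1 2 5 * a 2 * b 1
  + T 2 3 4 * T 3 4 5 * s2 (a 3) * b 2 + T 2 3 4 * T 2 4 5 * a 3 * s2 (b 2)
  + T 1 3 4 * T 3 4 5 * s2 (a 3) * b 1 + T 1 3 4 * T 1 4 5 * a 3 * s2 (b 1)
  + T 2 3 4 * T 3 4 5 * a 3 * b 2 * b 3 + T 1 3 4 * T 3 4 5 * a 3 * b 1 * b 3
  + T 1 3 4 * T 2 4 5 * a 3 * b 1 * b 2 + T 1 2 4 * T 3 4 5 * a 2 * b 1 * b 3
  + T 1 2 4 * T 3 4 5 * a 2 * a 3 * b 1
  + (T 1 2 3 * T 2 3 5 + T 1 2 4 * T 2 4 5) * a 2 * b 1 * b 2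
  + (T 1 2 3 * T 2 3 5 + T 1 2 4 * T 2 4 5) * s2 (a 2) * b 1
  + (T 1 2 3 * T 1 3 5 + T 1 2 4 * T 1 4 5) * a 2 * s2 (b 1)
  + T 1 2 3 * T 2 3 4 * T 2 4 5 * a 2 * b 1 * s2 (b 2)
  + T 1 2 3 * T 1 3 4 * T 2 4 5 * s2 (a 2) * s2 (b 1)
  + T 1 2 3 * T 2 3 4 * T 2 4 5 * s3 (a 2) * b 1
  + T 1 2 3 * T 1 3 4 * T 1 4 5 * a 2 * s3 (b 1)
  + T 1 2 3 * T 2 3 4 * T 2 4 5 * s2 (a 2) * b 1 * b 2
  + T 1 2 3 * T 1 3 4 * T 2 4 5 * a 2 * s2 (b 1) * b 2.

Definition hall (i : 'I_5) : P :=
  tnth [tuple hall1; hall2; hall3; hall4; hall5] i.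

End HallPoly.

(* Main.v *)
From HB Require Import structures.
From mathcomp Require Import all_boot all_order all_algebra all_classical.
From mathcomp Require Import mpoly ring lra zify.
Require Import Defs.

(** Right multiplication of a collected word by a power [g_i ^ m] is an explicit
    map on exponent vectors, polynomial in the vector and in [m]. Multiplying
    by g_1^b_1, then by g_2^b_2, up to g_5^b_5, composes five such maps, and
    the composite is the given list of Hall polynomials; this comparison is an
    identity between polynomials with rational coefficients
    ([normal_wordM], [meval_hall]).

    For a single [g_i], the letter is moved left past the later generators.
    This replaces each later g_j by its conjugate under g_i, which the defining
    relations give as g_j times a word in g_(j+1), ..., g_5, so powers of these
    conjugates have to be collected too. That only involves right
    multiplication by generators after [g_i], so the maps are obtained in the
    order g_5, g_4, g_3, g_2, g_1 (lemmas [normal_word_mul5] to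
    [normal_word_mul1]). The passage from one letter to an arbitrary power, of
    either sign, is uniform: if F m satisfies F 0 = id and
    F (m + 1) = F 1 o F m and multiplication by w acts as F 1, then
    multiplication by w^m acts as F m ([mul_normal_word_expgz]). So each step
    is the guess of a formula and the verification of a polynomial identity.

    The identities involving g_1 hold only modulo two equations between the
    parameters, t123 t345 = 0 and t134 t245 = t124 t345 + t145 t234. This is
    where consistency enters. Conjugating g_4 and g_3 by both sides of
    g_2 g_1 = g_1 g_2 [g_2, g_1] and collecting gives two equalities of words
    that differ only in the exponent of g_5 ([consistency_123_345],
    [consistency_jacobi]); these exponents agree because g_5 has infinite
    order, the last factor of the central series being infinite
    ([last_gen_torsion_free]). *)

Set Implicit Arguments.
Unset Strict Implicit.
Unset Printing Implicit Defensive.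

Import Order.TTheory GRing.Theory Num.Theory.

Local Open Scope group_scope.

Local Notation "x ^^ m" := (expgz x m) (at level 29, left associativity).

(** * Integer powers in a group *)

Section IntegerPowers.
Variable G : groupType.
Implicit Types (x y z w : G) (m n : int).

Lemma expgz1 x : x ^^ 1%R = x. Proof. by []. Qed.

Lemma expgzSr x m : x ^^ (m + 1)%R = x ^^ m * x.
Proof.
case: m => [n|[|n]].
- rewrite (_ : (Posz n + 1)%R = Posz n.+1) /=; last by lia.
  exact: expgSr.
- by rewrite /= mulVg.
- rewrite (_ : (Negz n.+1 + 1)%R = Negz n) /=; last by lia.
  by rewrite [in RHS]expgS invgM mulgVK.
Qed.

(** Reduces a formula for all integer exponents to one step forward: the steps
    backward follow because right multiplication by [w] is injective. *)
Lemma expgz_rec (u : int -> G) w :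
  (forall m, u (m + 1)%R = u m * w) -> forall m, u m = u 0%R * w ^^ m.
Proof.
move=> uS; elim/int_rect => [|n IH|n IH]; first by rewrite mulg1.
- by rewrite intS addrC uS expgzSr mulgA IH.
- apply: (mulIg w); rewrite -mulgA -expgzSr -uS.
  by rewrite (_ : (- n.+1%:Z + 1)%R = (- n%:Z)%R) ?IH //; lia.
Qed.

Lemma expgzD x m n : x ^^ (m + n)%R = x ^^ m * x ^^ n.
Proof.
rewrite (@expgz_rec (fun k => x ^^ (m + k)%R) x) ?addr0 // => k.
by rewrite addrA expgzSr.
Qed.

Lemma expgzM x m n : x ^^ (m * n)%R = (x ^^ m) ^^ n.
Proof.
rewrite (@expgz_rec (fun k => x ^^ (m * k)%R) (x ^^ m)) ?mulr0 ?mul1g // => k.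
by rewrite mulrDr mulr1 expgzD.
Qed.

Lemma exp1gz m : 1 ^^ m = 1 :> G.
Proof.
by rewrite -[LHS]mul1g -(@expgz_rec (fun=> 1) 1) // => k; rewrite mulg1.
Qed.

Lemma conjgz x y m : (x ^^ m) ^ y = (x ^ y) ^^ m.
Proof.
rewrite (@expgz_rec (fun k => (x ^^ k) ^ y) (x ^ y)) ?conj1g ?mul1g // => k.
by rewrite expgzSr conjMg.
Qed.

Lemma mulg_expgzC x y z m : x * y ^^ m * z = x * z * (y ^ z) ^^ m.
Proof. by rewrite -mulgA (conjgC (y ^^ m)) conjgz mulgA. Qed.

Lemma mulg_expgzSr x y m : x * y ^^ m * y = x * y ^^ (m + 1)%R.
Proof. by rewrite expgzSr mulgA. Qed.

End IntegerPowers.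

(** * Integer-valued binomials *)

Local Open Scope ring_scope.

(** Integer-valued, so that exponents of group elements stay integers; locked,
    so that unification does not compute the quotients. *)
HB.lock Definition bin2 (x : int) : int :=
  (x * (x - 1) %/ 2)%Z.
HB.lock Definition bin3 (x : int) : int :=
  (x * (x - 1) * (x - 2) %/ 6)%Z.

Lemma bin2E x : (bin2 x)%:~R = x%:~R * (x%:~R - 1) / 2 :> rat.
Proof.
rewrite bin2.unlock /bin2.body.
suff /divzK/(congr1 (fun y => y%:~R : rat)) : (2 %| x * (x - 1))%Z.
  by rewrite !rmorphM rmorphB /= => <-; field.
rewrite [x](divz_eq x 2).
have : (x %% 2)%Z \in [:: 0; 1] by rewrite !inE; lia.
set y := (x %/ 2)%Z; set z := (x %% 2)%Z => hz.
(* The value at 2 y + z differs from the value at z by a multiple of 2. *)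
apply/dvdzP; exists (2 * y * y + 2 * y * z - y).
by move: hz; rewrite !inE => /orP[] /eqP ->; ring.
Qed.

Lemma bin3E x : (bin3 x)%:~R = x%:~R * (x%:~R - 1) * (x%:~R - 2) / 6 :> rat.
Proof.
rewrite bin3.unlock /bin3.body.
suff /divzK/(congr1 (fun y => y%:~R : rat)) : (6 %| x * (x - 1) * (x - 2))%Z.
  by rewrite !rmorphM !rmorphB /= => <-; field.
rewrite [x](divz_eq x 6).
have : (x %% 6)%Z \in [:: 0; 1; 2; 3; 4; 5] by rewrite !inE; lia.
set y := (x %/ 6)%Z; set z := (x %% 6)%Z => hz.
(* The value at 6 y + z differs from the value at z by a multiple of 6. *)
apply/dvdzP; exists (36 * y * y * y + 18 * y * y * (z - 1) + 3 * y * z * z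
  - 6 * y * z + 2 * y + (z * (z - 1) * (z - 2) %/ 6)%Z).
move: hz; rewrite !inE => /or4P[|||/or3P[]] /eqP ->;
  set d := (_ %/ 6)%Z; compute in d; rewrite {}/d; ring.
Qed.

Lemma int_eq_rat (x y : int) : x%:~R = y%:~R :> rat -> x = y.
Proof. exact: intr_inj. Qed.

(** Exponents are compared over the rationals, where [bin2] and [bin3] become
    polynomials and [field] applies. *)
Ltac to_rat :=
  rewrite ?(rmorphD, rmorphB, rmorphN, rmorphM) /= ?bin2E ?bin3E
    ?(rmorphD, rmorphB, rmorphN, rmorphM) /=.

(** * Collection of words in five generators *)

Definition Z5 : Type := (int * int * int * int * int)%type.

Local Close Scope ring_scope.

Section Collection.
Variables (G : groupType) (g1 g2 g3 g4 g5 : G).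
Variables t123 t124 t125 t134 t135 t145 t234 t235 t245 t345 : int.

Let c := g3 ^^ t123 * g4 ^^ t124 * g5 ^^ t125.

Hypotheses (J21 : g2 ^ g1 = g2 * c)
           (J31 : g3 ^ g1 = g3 * g4 ^^ t134 * g5 ^^ t135)
           (J41 : g4 ^ g1 = g4 * g5 ^^ t145) (J51 : g5 ^ g1 = g5)
           (J32 : g3 ^ g2 = g3 * g4 ^^ t234 * g5 ^^ t235)
           (J42 : g4 ^ g2 = g4 * g5 ^^ t245) (J52 : g5 ^ g2 = g5)
           (J43 : g4 ^ g3 = g4 * g5 ^^ t345) (J53 : g5 ^ g3 = g5)
           (J54 : g5 ^ g4 = g5).

Definition normal_word (a : Z5) : G :=
  let '(a1, a2, a3, a4, a5) := a in
  g1 ^^ a1 * g2 ^^ a2 * g3 ^^ a3 * g4 ^^ a4 * g5 ^^ a5.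

Local Notation C := normal_word.

(** The first two hypotheses are polynomial identities; only the third one,
    about a single factor [w], involves the group. *)
Lemma mul_normal_word_expgz (F : int -> Z5 -> Z5) w :
    (forall a, F 0%R a = a) ->
    (forall m a, F (m + 1)%R a = F 1%R (F m a)) ->
    (forall a, C a * w = C (F 1%R a)) ->
  forall m a, C a * w ^^ m = C (F m a).
Proof.
move=> F0 FS Fw m a; rewrite -[in LHS](F0 a).
by rewrite [RHS](@expgz_rec _ (fun k => C (F k a)) w) // => k; rewrite FS Fw.
Qed.

Local Open Scope ring_scope.

(** Below, [mul]k is the effect on exponents of right multiplication by
    [g]k to the power [m]; several indices, as in [mul45], refer to the power of
    a word that starts with the first of these generators. *)
Definition mul5 (m : int) (a : Z5) : Z5 :=
  let '(a1, a2, a3, a4, a5) := a in (a1, a2, a3, a4, a5 + m).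

Definition mul4 (m : int) (a : Z5) : Z5 :=
  let '(a1, a2, a3, a4, a5) := a in (a1, a2, a3, a4 + m, a5).

Definition mul45 (d m : int) (a : Z5) : Z5 :=
  let '(a1, a2, a3, a4, a5) := a in (a1, a2, a3, a4 + m, a5 + d * m).

Definition mul3 (m : int) (a : Z5) : Z5 :=
  let '(a1, a2, a3, a4, a5) := a in (a1, a2, a3 + m, a4, a5 + t345 * a4 * m).

Definition mul345 (d e m : int) (a : Z5) : Z5 :=
  let '(a1, a2, a3, a4, a5) := a in
  (a1, a2, a3 + m, a4 + d * m,
   a5 + t345 * a4 * m + t345 * d * bin2 m + e * m).

Definition mul2 (m : int) (a : Z5) : Z5 :=
  let '(a1, a2, a3, a4, a5) := a in
  (a1, a2 + m, a3, a4 + t234 * a3 * m,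
   a5 + t245 * a4 * m + t235 * a3 * m + t234 * t345 * bin2 a3 * m
   + t234 * t245 * a3 * bin2 m).

(** The formula for powers of [g2 * c], the conjugate of [g2] by [g1]; it is
    simplified by means of t123 * t345 = 0. *)
Definition mul2345 (m : int) (a : Z5) : Z5 :=
  let '(a1, a2, a3, a4, a5) := a in
  (a1, a2 + m, a3 + t123 * m,
   a4 + t124 * m + t234 * a3 * m + t123 * t234 * bin2 m,
   a5 + t125 * m + t245 * a4 * m + t235 * a3 * m
   + t234 * t345 * bin2 a3 * m + t124 * t245 * bin2 m
   + t234 * t245 * a3 * bin2 m + t123 * t235 * bin2 m
   + t123 * t234 * t245 * bin3 m).

(** Simplified by means of both equations between the parameters. *)
Definition mul1 (m : int) (a : Z5) : Z5 :=
  let '(a1, a2, a3, a4, a5) := a in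
  (a1 + m, a2, a3 + t123 * a2 * m,
   a4 + t124 * a2 * m + t134 * a3 * m
   + t123 * t134 * a2 * bin2 m + t123 * t234 * bin2 a2 * m,
   a5 + t145 * a4 * m + t135 * a3 * m + t125 * a2 * m
   + t134 * t345 * bin2 a3 * m + t134 * t145 * a3 * bin2 m
   + t124 * t345 * a2 * a3 * m
   + (t123 * t235 + t124 * t245) * bin2 a2 * m
   + (t123 * t135 + t124 * t145) * a2 * bin2 m
   + t123 * t134 * t245 * bin2 a2 * bin2 m
   + t123 * t234 * t245 * bin3 a2 * m
   + t123 * t134 * t145 * a2 * bin3 m).

Local Close Scope ring_scope.

(** [field] uses the equations [rel1] and [rel2] between the parameters as
    rewrite rules for the monomials on their left-hand sides. *)
Tactic Notation "vec_eq" :=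
  rewrite /mul1 /mul2345 /mul2 /mul345 /mul3 /mul45 /mul4 /mul5;
  congr (_, _, _, _, _); apply: int_eq_rat; to_rat; by field.
Tactic Notation "vec_eq" "using" constr(rel1) constr(rel2) :=
  rewrite /mul1 /mul2345 /mul2 /mul345 /mul3 /mul45 /mul4 /mul5;
  congr (_, _, _, _, _); apply: int_eq_rat; to_rat; by field: rel1 rel2.

Lemma normal_word_mul5 m a : C a * g5 ^^ m = C (mul5 m a).
Proof. by case: a => [[[[a1 a2] a3] a4] a5] /=; rewrite expgzD mulgA. Qed.

Lemma normal_word_mul4 m a : C a * g4 ^^ m = C (mul4 m a).
Proof.
move: m a; apply: mul_normal_word_expgz; last first.
- move=> [[[[a1 a2] a3] a4] a5] /=.
  by rewrite mulg_expgzC J54 mulg_expgzSr.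
- by move=> m [[[[a1 a2] a3] a4] a5]; vec_eq.
- by move=> [[[[a1 a2] a3] a4] a5]; vec_eq.
Qed.

Lemma normal_word_mul45 d m a : C a * (g4 * g5 ^^ d) ^^ m = C (mul45 d m a).
Proof.
move: m a; apply: mul_normal_word_expgz; last first.
- move=> [[[[a1 a2] a3] a4] a5].
  rewrite mulgA -[g4 in LHS]expgz1 normal_word_mul4 normal_word_mul5.
  by congr C; vec_eq.
- by move=> m [[[[a1 a2] a3] a4] a5]; vec_eq.
- by move=> [[[[a1 a2] a3] a4] a5]; vec_eq.
Qed.

Lemma normal_word_mul3 m a : C a * g3 ^^ m = C (mul3 m a).
Proof.
move: m a; apply: mul_normal_word_expgz; last first.
- move=> [[[[a1 a2] a3] a4] a5].
  rewrite [LHS]/= (mulg_expgzC _ g5) (mulg_expgzC _ g4) J43 J53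
    mulg_expgzSr.
  have -> : g1 ^^ a1 * g2 ^^ a2 * g3 ^^ (a3 + 1)%R
    = C (a1, a2, a3 + 1, 0, 0)%R by rewrite /= !mulg1.
  rewrite normal_word_mul45 normal_word_mul5.
  by congr C; vec_eq.
- by move=> m [[[[a1 a2] a3] a4] a5]; vec_eq.
- by move=> [[[[a1 a2] a3] a4] a5]; vec_eq.
Qed.

Lemma normal_word_mul345 d e m a :
  C a * (g3 * g4 ^^ d * g5 ^^ e) ^^ m = C (mul345 d e m a).
Proof.
move: m a; apply: mul_normal_word_expgz; last first.
- move=> [[[[a1 a2] a3] a4] a5].
  rewrite !mulgA -[g3 in LHS]expgz1.
  rewrite normal_word_mul3 normal_word_mul4 normal_word_mul5.
  by congr C; vec_eq.
- by move=> m [[[[a1 a2] a3] a4] a5]; vec_eq.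
- by move=> [[[[a1 a2] a3] a4] a5]; vec_eq.
Qed.

Lemma normal_word_mul2 m a : C a * g2 ^^ m = C (mul2 m a).
Proof.
move: m a; apply: mul_normal_word_expgz; last first.
- move=> [[[[a1 a2] a3] a4] a5].
  rewrite [LHS]/= (mulg_expgzC _ g5) (mulg_expgzC _ g4) (mulg_expgzC _ g3).
  rewrite J32 J42 J52 mulg_expgzSr.
  have -> : g1 ^^ a1 * g2 ^^ (a2 + 1)%R = C (a1, a2 + 1, 0, 0, 0)%R.
    by rewrite /= !mulg1.
  rewrite normal_word_mul345 normal_word_mul45 normal_word_mul5.
  by congr C; vec_eq.
- by move=> m [[[[a1 a2] a3] a4] a5]; vec_eq.
- by move=> [[[[a1 a2] a3] a4] a5]; vec_eq.
Qed.

Hypothesis g5_torsion_free : forall m, g5 ^^ m = 1 -> m = 0%R.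

Lemma normal_word_inj5 (a b : Z5) : a.1 = b.1 -> C a = C b -> a.2 = b.2.
Proof.
case: a b => [[[[a1 a2] a3] a4] a5] [[[[b1 b2] b3] b4] b5] /= [-> -> -> ->].
move=> /mulgI e; apply/eqP; rewrite -subr_eq0; apply/eqP.
by apply: g5_torsion_free; rewrite expgzD e -expgzD addrN.
Qed.

(** Both sides collect, for [x] among [g3] and [g4], to words with the same
    exponents of [g1] to [g4]; the exponents of [g5] then give the two
    consistency equations. *)
Lemma conj_swap x : c * (x ^ g2) ^ g1 = (x ^ g1) ^ g2 * c.
Proof.
have -> : (x ^ g2) ^ g1 = ((x ^ g1) ^ g2) ^ c.
  by rewrite -!conjgM conjgC J21 mulgA.
by rewrite -conjgC.
Qed.

Lemma normal_word_c : c = C (0, 0, t123, t124, t125)%R.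
Proof. by rewrite /= !mul1g. Qed.

Lemma normal_word0 : C (0, 0, 0, 0, 0)%R = 1.
Proof. by rewrite /= !mulg1. Qed.

Lemma normal_word_mul4g a : C a * g4 = C (mul4 1%R a).
Proof. exact: (normal_word_mul4 1%R). Qed.

Lemma normal_word_mul3g a : C a * g3 = C (mul3 1%R a).
Proof. exact: (normal_word_mul3 1%R). Qed.

(* Collects any product of generators after [g2], written to the right of a
   normal word. *)
Let normal_wordE := (normal_word_mul5, normal_word_mul4, normal_word_mul4g,
  normal_word_mul45, normal_word_mul3, normal_word_mul3g).

Lemma consistency_123_345 : (t123 * t345 = 0)%R.
Proof.
have := conj_swap g4.
rewrite J42 J41 !conjMg !conjgz J42 J41 J51 J52.
rewrite -[RHS]mul1g -normal_word0 [in LHS]normal_word_c /c !mulgA.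
rewrite !normal_wordE => /normal_word_inj5.
rewrite /mul5 /mul45 /mul4 /mul3 /= => e.
have {}e := e ltac:(congr (_, _, _, _); ring); lra.
Qed.

Lemma consistency_jacobi : (t134 * t245 = t124 * t345 + t145 * t234)%R.
Proof.
have := conj_swap g3.
rewrite J32 J31 !conjMg !conjgz J32 J31 J42 J41 J51 J52.
rewrite -[RHS]mul1g -normal_word0 [in LHS]normal_word_c /c !mulgA.
rewrite !normal_wordE => /normal_word_inj5.
rewrite /mul5 /mul45 /mul4 /mul3 /= => e.
have {}e := e ltac:(congr (_, _, _, _); ring).
(* Collecting [c] on the right leaves a multiple of [t123 * t345]. *)
by rewrite [(t345 * _ * t123)%R]mulrAC [(t345 * t123)%R]mulrC
  consistency_123_345 in e; lra.
Qed.

Let rel_123_345 : (t123%:~R * t345%:~R = 0 :> rat)%R.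
Proof. by rewrite -intrM consistency_123_345. Qed.

(* As rewrite rules, the two relations have coprime leading monomials,
   [t123 * t345] and [t134 * t245], and thus decide equality modulo the ideal
   that they generate. *)
Let rel_jacobi :
  (t134%:~R * t245%:~R = t124%:~R * t345%:~R + t145%:~R * t234%:~R :> rat)%R.
Proof. by rewrite -!intrM -intrD consistency_jacobi. Qed.

Lemma normal_word_mul2345 m a : C a * (g2 * c) ^^ m = C (mul2345 m a).
Proof.
move: m a; apply: mul_normal_word_expgz; last first.
- move=> [[[[a1 a2] a3] a4] a5].
  rewrite /c !mulgA -[g2 in LHS]expgz1 normal_word_mul2.
  rewrite normal_word_mul3 normal_word_mul4 normal_word_mul5.
  by congr C; vec_eq using rel_123_345 rel_jacobi.
- by move=> m [[[[a1 a2] a3] a4] a5]; vec_eq using rel_123_345 rel_jacobi.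
- by move=> [[[[a1 a2] a3] a4] a5]; vec_eq.
Qed.

Lemma normal_word_mul1 m a : C a * g1 ^^ m = C (mul1 m a).
Proof.
move: m a; apply: mul_normal_word_expgz; last first.
- move=> [[[[a1 a2] a3] a4] a5].
  rewrite [LHS]/= (mulg_expgzC _ g5) (mulg_expgzC _ g4) (mulg_expgzC _ g3).
  rewrite (mulg_expgzC _ g2) J21 J31 J41 J51 -expgzSr.
  have -> : g1 ^^ (a1 + 1)%R = C (a1 + 1, 0, 0, 0, 0)%R.
    by rewrite /= !mulg1.
  rewrite normal_word_mul2345 normal_word_mul345 normal_word_mul45.
  rewrite normal_word_mul5.
  by congr C; vec_eq using rel_123_345 rel_jacobi.
- by move=> m [[[[a1 a2] a3] a4] a5]; vec_eq using rel_123_345 rel_jacobi.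
- by move=> [[[[a1 a2] a3] a4] a5]; vec_eq.
Qed.

Definition product_exponents (a b : Z5) : Z5 :=
  let '(b1, b2, b3, b4, b5) := b in
  mul5 b5 (mul4 b4 (mul3 b3 (mul2 b2 (mul1 b1 a)))).

Lemma normal_wordM a b : C a * C b = C (product_exponents a b).
Proof.
case: b => [[[[b1 b2] b3] b4] b5] /=.
rewrite !mulgA normal_word_mul1 normal_word_mul2 normal_word_mul3.
by rewrite normal_word_mul4 normal_word_mul5.
Qed.

End Collection.

(** * The presented group *)

Section Presented.
Variables (n : nat) (R : word n -> word n -> Prop).
Local Notation cls := (@pres_class n R).

Lemma pres_classM u v : cls (u * v) = cls u * cls v.
Proof.
apply/pres_classP; apply: Pres_sym.
by apply: Pres_mul; exact: pres_eq_repr.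
Qed.

Lemma pres_class1 : cls 1 = 1. Proof. by []. Qed.

Lemma pres_classV u : cls u^-1 = (cls u)^-1.
Proof.
apply: (mulgI (cls u)); rewrite mulgV -pres_classM.
by apply/pres_classP; exact: Pres_mulV.
Qed.

Lemma pres_class_expgz u m : cls (u ^^ m) = cls u ^^ m.
Proof.
have clsX k : cls (u ^+ k) = cls u ^+ k.
  elim: k => [//|[//|k] IH].
  by rewrite [X in cls X]expgSS pres_classM [in LHS]IH -expgS.
by case: m => k /=; rewrite ?pres_classV clsX.
Qed.

End Presented.

Section Relations.
Variable t : family.
Local Notation g i := (@Ggen t i).

Lemma Ggen_comm (i j : 'I_5) : i < j ->
  [~ g j, g i] = \prod_(k < 5 | j < k) g k ^^ t i.+1 j.+1 k.+1.
Proof.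
move=> ij; have /Pres_rel/pres_classP := Grel_comm t ij.
rewrite (big_morph _ (@pres_classM _ _) (@pres_class1 _ _)).
rewrite !(pres_classM, pres_classV) => e; apply: (etrans e).
by apply: eq_bigr => k _; rewrite pres_class_expgz.
Qed.

Lemma Ggen_conj (i j : 'I_5) : i < j ->
  g j ^ g i = g j * \prod_(k < 5 | j < k) g k ^^ t i.+1 j.+1 k.+1.
Proof. by move=> ij; rewrite -(Ggen_comm ij) commgEl mulVKg. Qed.

End Relations.

(** * Exponents of the last generator *)

(** If [x ^^ m = 1] with [m != 0], the group generated by [x] has at most |m|
    elements, and so at most |m| cosets. *)
Lemma infinite_lcosets_torsion_free (G : groupType) (x : G) (K : set G) m :
  infinite_set (lcosets (gensub [set x]%classic) K) -> x ^^ m = 1 -> m = 0%R.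
Proof.
move=> inf xm1; apply/eqP; apply/negP => m0; apply: inf.
pose coset h := [set h * k | k in K]%classic.
apply: (@sub_finite_set _ _
  ((fun k => coset (x ^+ k)) @` `I_(absz m))%classic); last first.
  by apply: finite_image; exact: finite_II.
move=> _ [h Hh <-].
have [k ->] : exists k, h = x ^^ k.
  elim: Hh => {h} [y ->|||].
  - by exists 1%R.
  - by exists 0%R.
  - by move=> _ _ _ [k ->] _ [l ->]; exists (k + l)%R; rewrite expgzD.
  - move=> _ _ [k ->]; exists (- k)%R; apply: (mulgI (x ^^ k)).
    by rewrite mulgV -expgzD addrN.
exists (absz (k %% m)%Z); first by rewrite /=; lia.
congr coset; rewrite [in RHS](divz_eq k m) mulrC expgzD expgzM xm1.
rewrite exp1gz mul1g -[in RHS](@gez0_abs (k %% m)%Z) //; lia.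
Qed.

(** * Comparison with the Hall polynomials *)

Definition exponents (a : 'rV[int]_5) : Z5 :=
  (a ord0 (inord 0), a ord0 (inord 1), a ord0 (inord 2), a ord0 (inord 3),
   a ord0 (inord 4)).

Definition row_of_exponents (v : Z5) : 'rV[int]_5 :=
  let '(v1, v2, v3, v4, v5) := v in
  (\row_i tnth [tuple v1; v2; v3; v4; v5] i)%R.

Lemma row_of_exponentsK v : exponents (row_of_exponents v) = v.
Proof.
case: v => [[[[v1 v2] v3] v4] v5].
by rewrite /exponents !mxE !(tnth_nth 0%R) !inordK.
Qed.

Lemma collectedE (G : groupType) (g : 'I_5 -> G) a :
  collected g a =
  normal_word (g 0%R) (g 1%R) (g 2%R) (g 3%R) (g 4%R) (exponents a).
Proof.
rewrite /collected !big_ord_recr big_ord0 /= mul1g.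
by congr (g _ ^^ a _ _ * g _ ^^ a _ _ * g _ ^^ a _ _ * g _ ^^ a _ _
  * g _ ^^ a _ _); apply: val_inj; rewrite //= inordK.
Qed.

Section Evaluation.
Variables (m : nat) (v : 'I_m -> rat).
Local Open Scope ring_scope.

Lemma meval_int (z : int) : (z%:~R : {mpoly rat[m]}).@[v] = z%:~R.
Proof. exact: rmorph_int. Qed.

Lemma meval_s2 x : (s2 x).@[v] = x.@[v] * (x.@[v] - 1) / 2.
Proof. by rewrite /s2 mevalZ mevalM mevalB meval1 mulrC. Qed.

Lemma meval_s3 x :
  (s3 x).@[v] = x.@[v] * (x.@[v] - 1) * (x.@[v] - 2) / 6.
Proof. by rewrite /s3 mevalZ !mevalM !mevalB meval1 rmorph_nat mulrC. Qed.

End Evaluation.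

Section ConsistentPresentation.
Variable t : family.
Local Notation T i j k := (t i%N j%N k%N).
Local Notation x1 := (@Ggen t 0%R).
Local Notation x2 := (@Ggen t 1%R).
Local Notation x3 := (@Ggen t 2%R).
Local Notation x4 := (@Ggen t 3%R).
Local Notation x5 := (@Ggen t 4%R).

Lemma last_gen_torsion_free :
  consistent t -> forall m, x5 ^^ m = 1 -> m = 0%R.
Proof.
move=> [_ inf] m.
apply: (@infinite_lcosets_torsion_free _ _ (tailsub (@Ggen t) 5)).
rewrite (_ : [set x5]%classic
  = [set @Ggen t k | k in [set k : 'I_5 | 4 <= k]]%classic); first exact: inf.
apply/seteqP; split=> [_ -> | _ [k hk <-]] /=; first by exists 4%R.
by congr (@Ggen t _); apply: val_inj => /=; move: hk (ltn_ord k) => /=; lia.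
Qed.

Ltac expand_relation :=
  rewrite Ggen_conj // big_mkcond !big_ord_recr big_ord0 /=;
  rewrite ?mul1g ?mulg1 ?mulgA;
  repeat f_equal; exact: val_inj.

Let J21 : x2 ^ x1 = x2 * (x3 ^^ T 1 2 3 * x4 ^^ T 1 2 4 * x5 ^^ T 1 2 5).
Proof. expand_relation. Qed.

Let J31 : x3 ^ x1 = x3 * x4 ^^ T 1 3 4 * x5 ^^ T 1 3 5.
Proof. expand_relation. Qed.

Let J41 : x4 ^ x1 = x4 * x5 ^^ T 1 4 5.
Proof. expand_relation. Qed.

Let J51 : x5 ^ x1 = x5.
Proof. expand_relation. Qed.

Let J32 : x3 ^ x2 = x3 * x4 ^^ T 2 3 4 * x5 ^^ T 2 3 5.
Proof. expand_relation. Qed.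

Let J42 : x4 ^ x2 = x4 * x5 ^^ T 2 4 5.
Proof. expand_relation. Qed.

Let J52 : x5 ^ x2 = x5.
Proof. expand_relation. Qed.

Let J43 : x4 ^ x3 = x4 * x5 ^^ T 3 4 5.
Proof. expand_relation. Qed.

Let J53 : x5 ^ x3 = x5.
Proof. expand_relation. Qed.

Let J54 : x5 ^ x4 = x5.
Proof. expand_relation. Qed.

Hypothesis ht : consistent t.

Let tf := last_gen_torsion_free ht.

Let rel_123_345 : ((T 1 2 3)%:~R * (T 3 4 5)%:~R = 0 :> rat)%R.
Proof.
by rewrite -intrM (consistency_123_345 J21 J41 J51 J42 J52 J43 J53 J54 tf).
Qed.

Let rel_jacobi : ((T 1 3 4)%:~R * (T 2 4 5)%:~R =
  (T 1 2 4)%:~R * (T 3 4 5)%:~R + (T 1 4 5)%:~R * (T 2 3 4)%:~R :> rat)%R.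
Proof.
rewrite -!intrM -intrD.
by rewrite (consistency_jacobi J21 J31 J41 J51 J32 J42 J52 J43 J53 J54 tf).
Qed.

Let product := product_exponents (T 1 2 3) (T 1 2 4) (T 1 2 5) (T 1 3 4)
  (T 1 3 5) (T 1 4 5) (T 2 3 4) (T 2 3 5) (T 2 4 5) (T 3 4 5).

Lemma collectedM a b : collected (@Ggen t) a * collected (@Ggen t) b =
  collected (@Ggen t) (row_of_exponents (product (exponents a) (exponents b))).
Proof.
rewrite !collectedE row_of_exponentsK.
exact: (normal_wordM J21 J31 J41 J51 J32 J42 J52 J43 J53 J54 tf).
Qed.

(** The composite of the five multiplication maps also has terms such as
    t123 t134 t345 a2 s2(b1) b3, from [mul3] after [mul1], which are not in the
    Hall polynomials; they vanish by the first consistency equation. *)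
Lemma meval_hall (a b : 'rV[int]_5) i :
  ((hall t i).@[fun k => (row_mx a b ord0 k)%:~R] =
   (row_of_exponents (product (exponents a) (exponents b)) ord0 i)%:~R)%R.
Proof.
set v := fun k => _.
have evalA k : ('X_(lshift 5 (inord k)) : {mpoly rat[5 + 5]}).@[v]%R
    = (a ord0 (inord k))%:~R%R.
  by rewrite mevalXU /v row_mxEl.
have evalB k : ('X_(rshift 5 (inord k)) : {mpoly rat[5 + 5]}).@[v]%R
    = (b ord0 (inord k))%:~R%R.
  by rewrite mevalXU /v row_mxEr.
rewrite /product /product_exponents /exponents.
rewrite /mul1 /mul2 /mul3 /mul4 /mul5 mxE /hall.
case: i => [[|[|[|[|[|//]]]]] hi]; rewrite !(tnth_nth 0%R) /=
  /hall1 /hall2 /hall3 /hall4 /hall5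
  ?(mevalD, mevalM, meval_s2, meval_s3, meval_int, evalA, evalB);
  to_rat; by field: rel_123_345 rel_jacobi.
Qed.

End ConsistentPresentation.

Theorem theorem3 (t : family) (ht : consistent t) :
  Hall_polynomials (@Ggen t) (hall t).
Proof.
move=> a b; eexists; last exact: (collectedM ht).
by move=> i; exact: meval_hall.
Qed.
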